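(* Consider a general-type company with agency-cost function $\rho(\cdot)$, threshold $\bar s(c)=\frac{c-\rho(c)}{1-\rho(c)}$ and liquidity index $ILL_{s_0}(c,\lambda)$ as defined in the context. Let $0<c^2<c^1<1$ be two values of the governance parameter (superscripts are indices, not powers) and set $$\Delta_c ILL_{s_0}(\lambda)=ILL_{s_0}(c^2,\lambda)-ILL_{s_0}(c^1,\lambda).$$ Let $0\le\lambda^l<\lambda^h$. Then for every $s_0\ge0$ with $s_0<\bar s(c^1)$ and $s_0<\bar s(c^2)$, $$\Delta_c ILL_{s_0}(\lambda^h)>\Delta_c ILL_{s_0}(\lambda^l).$$
   Context: Fixed data: a real $\bar V>0$ (value of a share without agency cost), integers $N_I\ge0$ (number of informed traders) and $M\ge1$ (number of deals) with $M\ge N_I$, and $\Delta T>0$. Agency cost (general-type company): $\theta\in(0,1)$ and $f:(0,1)\to(0,\infty)$ is twice differentiable with $f'>0$ and $f''<0$. The agency cost of a company with governance parameter $c\in(0,1)$ (smaller $c$ means better governance) is $\rho(c)=\frac{1-\theta}{2}f(c)$, and it is assumed that $0\le\rho(c)\le c$ for all $c\in(0,1)$. Market model for given $c\in(0,1)$ and $\lambda\ge0$ (degree of noise traders' participation): write $\rho=\rho(c)$, $V(\rho)=(1-\rho)\bar V$ (fair value of a share) and $\underline V=(1-c)\bar V$. The number $N_U$ of participating noise traders is Poisson distributed with parameter $\lambda\Delta T$ ($N_U=0$ a.s. if $\lambda=0$). Each noise trader has an estimate of the share value; the estimates are i.i.d. uniform on $[\underline V,\bar V]$ and independent of $N_U$.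 Each of the $N_I$ informed traders has estimate $V(\rho)$. Let $N=N_I+N_U$ and let $\hat V^{(1)}\ge\dots\ge\hat V^{(N)}$ be all $N$ estimates in descending order. The market price after the $M$ deals is $$P_{T_2}=\hat V^{(M+1)}\ \text{ if } N>M,\qquad P_{T_2}=\underline V\ \text{ if } N\le M.$$ Let $\bar s(c)=\frac{c-\rho(c)}{1-\rho(c)}$. For $s_0\in[0,1)$ let $F_{s_0}(c,\lambda)=\Pr[P_{T_2}<(1-s_0)V(\rho)]$, and let $ILL_{s_0}(c,\lambda)=-\ln F_{s_0}(c,\lambda)$ if $F_{s_0}(c,\lambda)>0$ and $ILL_{s_0}(c,\lambda)=+\infty$ if $F_{s_0}(c,\lambda)=0$. For $s_0<\bar s(c)$ the index is finite. A larger $ILL_{s_0}$ means higher liquidity. *)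

(* Defs.v *)
From HB Require Import structures.
From mathcomp Require Import all_boot all_order all_algebra.
From mathcomp Require Import finmap.
From mathcomp Require Import all_classical all_reals all_analysis.

Set Implicit Arguments.
Unset Strict Implicit.
Unset Printing Implicit Defensive.

Import Order.TTheory GRing.Theory Num.Theory.
Import numFieldNormedType.Exports.

Local Open Scope classical_set_scope.
Local Open Scope ring_scope.

(* Only the values of [f] on (0,1) matter: derivatives at interior points are
   local. *)
Definition agency_shape (R : realType) (f : R -> R) : Prop :=
  forall x : R, 0 < x < 1 ->
    [/\ 0 < f x,
        derivable f x 1 /\ derivable (derive1 f) x 1,
        0 < derive1 f x
      & derive1 (derive1 f) x < 0].

Definition agency_cost (R : realType) (theta : R) (f : R -> R) (c : R) : R :=
  (1 - theta) / 2 * f c.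

Definition fair_value (R : realType) (Vbar rho : R) : R := (1 - rho) * Vbar.

Definition low_value (R : realType) (Vbar c : R) : R := (1 - c) * Vbar.

Definition liquidity_threshold (R : realType) (c rho : R) : R :=
  (c - rho) / (1 - rho).

Definition sigma_of d d' (T : measurableType d) (T' : measurableType d')
    (X : T -> T') : set (set T) :=
  [set X @^-1` B | B in measurable].

Definition mutually_independent d (T : measurableType d) (R : realType)
    (P : probability T R) (I : choiceType) (E : I -> set (set T)) : Prop :=
  forall (J : {fset I}) (A : I -> set T),
    (forall i, i \in J -> E i (A i)) ->
    P (\bigcap_(i in [set` J]) A i) = (\prod_(i <- J) P (A i))%E.

(* An infinite sequence of potential noise traders' estimates is given; only
   the first [noise_count w] of them are present in the scenario [w]. *)
Record noise_model (R : realType) := NoiseModel {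
  nm_disp : measure_display ;
  nm_space : measurableType nm_disp ;
  nm_prob : probability nm_space R ;
  noise_count : {RV nm_prob >-> nat} ;
  noise_estimate : nat -> {RV nm_prob >-> R} }.

(* [None] indexes the number of noise traders, [Some i] the i-th estimate. *)
Definition noise_sigma (R : realType) (X : noise_model R) (j : option nat) :
    set (set (nm_space X)) :=
  if j is Some i then sigma_of (noise_estimate X i)
  else sigma_of (noise_count X).

(* The second argument [0%N] of [poisson_prob] is a dummy.  For rate 0 this
   law is the Dirac mass at 0.  Estimates are uniform on
   [low_value Vbar c, Vbar], a nondegenerate interval when 0 < c, 0 < Vbar. *)
Definition noise_law (R : realType) (Vbar dT c lambda : R)
    (X : noise_model R) : Prop :=
  [/\ forall B : set nat,
        distribution (nm_prob X) (noise_count X) B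
          = poisson_prob (lambda * dT) 0%N B,
      exists ab : low_value Vbar c < Vbar,
        forall (i : nat) (B : set R), measurable B ->
          distribution (nm_prob X) (noise_estimate X i) B = uniform_prob ab B
    & mutually_independent (nm_prob X) (@noise_sigma R X)].

Definition estimates (R : realType) (Vbar : R) (NI : nat) (rho : R)
    (X : noise_model R) (w : nm_space X) : seq R :=
  nseq NI (fair_value Vbar rho)
    ++ [seq noise_estimate X i w | i <- iota 0 (noise_count X w)].

(* [nth] counts from 0: the item of index [M] is the (M+1)-th largest. *)
Definition market_price (R : realType) (Vbar : R) (NI M : nat) (c rho : R)
    (X : noise_model R) (w : nm_space X) : R :=
  let s := sort >=%R (estimates Vbar NI rho w) in
  if (M < size s)%N then nth 0 s M else low_value Vbar c.

Definition price_drop_prob (R : realType) (Vbar : R) (NI M : nat) (c rho : R)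
    (X : noise_model R) (s0 : R) : R :=
  fine (nm_prob X
    [set w | market_price Vbar NI M c rho w < (1 - s0) * fair_value Vbar rho]).

Definition ILL (R : realType) (Vbar : R) (NI M : nat) (c rho : R)
    (X : noise_model R) (s0 : R) : \bar R :=
  let F := price_drop_prob Vbar NI M c rho X s0 in
  if 0 < F then (- ln F)%:E else +oo%E.

(* [X c lambda] is the market with governance parameter [c] and participation
   [lambda]. *)
Definition delta_ILL (R : realType) (Vbar : R) (NI M : nat) (rho : R -> R)
    (X : R -> R -> noise_model R) (c1 c2 s0 lambda : R) : \bar R :=
  (ILL Vbar NI M c2 (rho c2) (X c2 lambda) s0
   - ILL Vbar NI M c1 (rho c1) (X c1 lambda) s0)%E.

(* Main.v *)
Require Import Defs.
From HB Require Import structures.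
From mathcomp Require Import all_boot all_order all_algebra.
From mathcomp Require Import finmap.
From mathcomp Require Import all_classical all_reals all_analysis.
From mathcomp Require Import ring lra.

Set Implicit Arguments.
Unset Strict Implicit.
Unset Printing Implicit Defensive.

Import Order.TTheory GRing.Theory Num.Theory.
Import numFieldNormedType.Exports.

Local Open Scope classical_set_scope.
Local Open Scope ring_scope.

(* A share price below [(1 - s0) * V(rho)] means that at most [M - NI] noise
   traders have an estimate at or above that level.  By Poisson thinning the
   number of those traders is Poisson with parameter [lambda * dT * p(c)],
   where [p(c) = (s0 + (1 - s0) * rho(c)) / c], so [ILL] is [H (lambda * dT *
   p(c))] with [H = - ln] of the Poisson distribution function at [M - NI].
   Now [p] is decreasing, since [f] concave and positive makes [f(c) / c]
   decreasing, and [u * H'(u)] is increasing, so that the derivative of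
   [H (lambda * p(c2)) - H (lambda * p(c1))] in [lambda] is positive. *)

(** * Truncated exponential series and the Poisson distribution function *)

Definition exp_sum (R : realType) (m : nat) (x : R) : R :=
  \sum_(0 <= k < m.+1) x ^+ k / k`!%:R.

Lemma exp_sum_gt0 (R : realType) (m : nat) (x : R) : 0 <= x -> 0 < exp_sum m x.
Proof.
move=> x0; rewrite /exp_sum big_nat_recl// expr0 fact0 divr1.
by rewrite ltr_wpDr// sumr_ge0// => k _; rewrite divr_ge0// exprn_ge0.
Qed.

Lemma exp_sumS (R : realType) (m : nat) (x : R) :
  exp_sum m.+1 x = exp_sum m x + x ^+ m.+1 / m.+1`!%:R.
Proof. by rewrite /exp_sum big_nat_recr. Qed.

(* The derivative is [exp_sum m.-1 x], except at [m = 0] where it is [0]. *)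
Lemma is_derive_exp_sum (R : realType) (m : nat) (x : R) :
  is_derive x 1 (@exp_sum R m) (exp_sum m x - x ^+ m / m`!%:R).
Proof.
elim: m => [|m IH].
  have -> : @exp_sum R 0 = cst 1.
    by apply/funext => y; rewrite /exp_sum big_nat1 expr0 fact0 divr1.
  by apply: is_derive_eq; rewrite /= expr0 fact0 divr1 subrr.
rewrite exp_sumS addrK.
have -> : @exp_sum R m.+1 = @exp_sum R m + (m.+1`!%:R^-1 \*: (@id R) ^+ m.+1).
  apply/funext => y; rewrite exp_sumS mulrC.
  by rewrite [RHS]/= /GRing.scale/= exprfctE.
apply: is_derive_eq.
rewrite scaler1 /GRing.scale/= factS natrM.
have m1 : m.+1%:R != 0 :> R by rewrite pnatr_eq0.
have mf : m`!%:R != 0 :> R by rewrite pnatr_eq0 -lt0n fact_gt0.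
by field; rewrite mf nat1r m1.
Qed.

(** After cross-multiplication the sums compare term by term: for [k <= m], dividing
    [v ^+ m.+1 * u ^+ k < u ^+ m.+1 * v ^+ k] by [u ^+ k * v ^+ k] leaves powers with the positive
    exponent [m.+1 - k]. *)
Lemma exp_sum_ratio_lt (R : realType) (m : nat) (u v : R) :
  0 < v -> v < u ->
  v ^+ m.+1 / exp_sum m v < u ^+ m.+1 / exp_sum m u.
Proof.
move=> v0 vu; have u0 := lt_trans v0 vu.
rewrite ltr_pdivrMr ?exp_sum_gt0 ?ltW// mulrAC.
rewrite ltr_pdivlMr ?exp_sum_gt0 ?ltW// /exp_sum !mulr_sumr.
rewrite !big_mkord; apply: ltr_sum => [|[k /= km] _].
  by apply/hasP; exists ord0; rewrite ?mem_index_enum.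
rewrite !mulrA ltr_pM2r ?invr_gt0 ?ltr0n ?fact_gt0//.
have -> : m.+1 = ((m.+1 - k) + k)%N by rewrite subnK// ltnW.
rewrite !exprD -!mulrA [v ^+ k * _]mulrC ltr_pM2r ?mulr_gt0 ?exprn_gt0//.
by rewrite ltrXn2r ?subn_eq0 -?ltnNge// ltW.
Qed.

Definition poisson_cdf (R : realType) (m : nat) (mu : R) : R :=
  expR (- mu) * exp_sum m mu.

Lemma poisson_cdf_gt0 (R : realType) (m : nat) (mu : R) :
  0 <= mu -> 0 < poisson_cdf m mu.
Proof. by move=> mu0; rewrite mulr_gt0 ?expR_gt0 ?exp_sum_gt0. Qed.

Lemma ln_poisson_cdf (R : realType) (m : nat) (mu : R) :
  0 <= mu -> - ln (poisson_cdf m mu) = mu - ln (exp_sum m mu).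
Proof.
move=> mu0; rewrite lnM ?posrE ?expR_gt0 ?exp_sum_gt0//.
by rewrite expRK opprD opprK.
Qed.

(** By [ln_poisson_cdf] the function is [- ln (poisson_cdf m (y * p))] for [0 <= y]. Differentiating
    [S = exp_sum m] drops only its top term, so [1 - S' / S] is that top term over [S]. *)
Lemma is_derive_illiquidity (R : realType) (m : nat) (p x : R) :
  0 <= p -> 0 <= x ->
  is_derive x 1 (fun y => y * p - ln (exp_sum m (y * p)))
    (p * ((x * p) ^+ m / m`!%:R / exp_sum m (x * p))).
Proof.
move=> p0 x0.
have S0 : 0 < exp_sum m (x * p) by rewrite exp_sum_gt0 ?mulr_ge0.
have dp : is_derive x 1 ( *%R^~ p) p.
  have -> : *%R^~ p = p *: (@id R) by apply/funext => y; rewrite /= mulrC.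
  by apply: is_derive_eq; rewrite /GRing.scale/= mulr1.
have dS := is_derive_exp_sum m (x * p).
have dSp := @is_derive1_comp _ _ ( *%R^~ p) _ _ _ dS dp.
have dl := is_derive1_ln S0.
have dlS := @is_derive1_comp _ _ (@exp_sum R m \o *%R^~ p) _ _ _ dl dSp.
apply: is_derive_eq (is_deriveB dp dlS) _.
have mf : m`!%:R != 0 :> R by rewrite pnatr_eq0 -lt0n fact_gt0.
by field; rewrite mf gt_eqF.
Qed.

(* The derivative of [- ln (poisson_cdf m (lambda * p))] in [lambda] is
   [u ^+ m.+1 / exp_sum m u] at [u = lambda * p], up to the factor
   [lambda * m!], so it increases with [p]. *)
Lemma poisson_cdf_log_supermodular (R : realType) (m : nat) (p1 p2 a b : R) :
  0 < p1 -> p1 < p2 -> 0 <= a -> a < b ->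
  ln (poisson_cdf m (a * p1)) - ln (poisson_cdf m (a * p2))
    < ln (poisson_cdf m (b * p1)) - ln (poisson_cdf m (b * p2)).
Proof.
move=> p10 p12 a0 ab.
have p20 := lt_trans p10 p12; have b0 := le_lt_trans a0 ab.
pose g p := fun y : R => y * p - ln (exp_sum m (y * p)).
have gE (y p : R) : 0 <= y -> 0 < p -> ln (poisson_cdf m (y * p)) = - g p y.
  by move=> y0 p0; rewrite -[LHS]opprK ln_poisson_cdf// mulr_ge0// ltW.
rewrite !gE ?(ltW b0)// ![- _ - - _]addrC !opprK.
have d (x : R) (x0 : 0 <= x) :=
  is_deriveB (is_derive_illiquidity m (ltW p20) x0)
             (is_derive_illiquidity m (ltW p10) x0).
have dx x : x \in `[a, b] -> derivable (g p2 - g p1) x 1.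
  rewrite in_itv/= => /andP[ax _].
  by apply: (@ex_derive _ _ _ _ _ _ _ (d x _)); exact: le_trans ax.
apply: (@gtr0_derive1_lt_cc _ (g p2 - g p1) a b) => //.
- by move=> x xab; apply: dx; exact: subset_itv_oo_cc xab.
- move=> x; rewrite in_itv/= => /andP[ax _].
  have x0 := le_lt_trans a0 ax.
  rewrite derive1E (@derive_val _ _ _ _ _ _ _ (d x (ltW x0))) subr_gt0.
  (* Only interior points occur here, so [x > 0]; the factor turns both derivatives into values of
     the increasing ratio of [exp_sum_ratio_lt]. *)
  rewrite -(ltr_pM2l (x := x * m`!%:R)); last first.
    by rewrite mulr_gt0// ltr0n fact_gt0.
  have E p : 0 < p -> x * m`!%:R * (p * ((x * p) ^+ m / m`!%:R / exp_sum m (x * p)))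
      = (x * p) ^+ m.+1 / exp_sum m (x * p).
    move=> p0; have S0 : 0 < exp_sum m (x * p).
      by rewrite exp_sum_gt0// mulr_ge0// ltW.
    have mf : m`!%:R != 0 :> R by rewrite pnatr_eq0 -lt0n fact_gt0.
    by rewrite exprS; field; rewrite mf gt_eqF.
  rewrite !E//; apply: exp_sum_ratio_lt; first exact: mulr_gt0.
  by rewrite ltr_pM2l.
- exact: derivable_within_continuous.
- by rewrite in_itv/= lexx ltW.
- by rewrite in_itv/= lexx ltW.
Qed.

(** * Concavity of the agency cost *)

(** The mean value theorem gives the slope [derive1 f z] with [x < z < y]. As [derive1 f] is
    continuous on the closed interval and has negative derivative inside, it decreases strictly up
    to both ends. *)
Lemma agency_shape_chord (R : realType) (f : R -> R) (x y : R) :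
  agency_shape f -> 0 < x -> x < y -> y < 1 ->
  derive1 f y * (y - x) < f y - f x < derive1 f x * (y - x).
Proof.
move=> hf x0 xy y1.
have sub z : z \in `[x, y] -> 0 < z < 1.
  rewrite in_itv/= => /andP[xz zy].
  by rewrite (lt_le_trans x0 xz) (le_lt_trans zy y1).
have df z : z \in `[x, y] -> derivable f z 1 by move=> /sub /hf[_ []].
have ddf z : z \in `[x, y] -> derivable (derive1 f) z 1.
  by move=> /sub /hf[_ []].
have dec := @ltr0_derive1_lt_cc _ (derive1 f) x y
  (fun z zxy => ddf z (subset_itv_oo_cc zxy)).
have {}dec : {in `[x, y] &, {homo derive1 f : u v /~ u < v}}.
  apply: dec; last exact: derivable_within_continuous.
  by move=> z /subset_itv_oo_cc /sub /hf[].
have [|z zxy ->] := @MVT _ f (derive1 f) x y xy _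
    (derivable_within_continuous df).
  by move=> z /subset_itv_oo_cc zxy; rewrite derive1E; exact/derivableP/df.
have zc := subset_itv_oo_cc zxy.
move: zxy; rewrite in_itv/= => /andP[xz zy].
by rewrite !ltr_pM2r ?subr_gt0//; apply/andP; split; apply: dec => //;
  rewrite in_itv/= lexx ltW.
Qed.

(* If the tangent at [t] were negative at [0], it would vanish at some [e] in
   [(0, t)], where by concavity it lies above [f e > 0]. *)
Lemma agency_shape_tangent (R : realType) (f : R -> R) (t : R) :
  agency_shape f -> 0 < t < 1 -> t * derive1 f t <= f t.
Proof.
move=> hf t01; have [ft0 _ df0 _] := hf t t01; have /andP[t0 t1] := t01.
rewrite leNgt; apply/negP => lt_f.
pose e := t - f t / derive1 f t.
have e0 : 0 < e by rewrite subr_gt0 ltr_pdivrMr.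
have et : e < t by rewrite gtrBl divr_gt0.
have /andP[+ _] := agency_shape_chord hf e0 et t1.
(* For this [e] the product [derive1 f t * (t - e)] is [f t], so the chord bound would force
   [f e < 0]. *)
rewrite /e opprB addrC subrK mulrC divfK ?gt_eqF//.
have [fe0 _ _ _] := hf e ltac:(by rewrite e0 (lt_trans et)).
by rewrite ltrBrDl gtrDr ltNge ltW.
Qed.

(** Chord and tangent bounds at [x] give [f y < f x + derive1 f x * (y - x) <= f x + f x / x * (y -
    x) = f x * y / x]. *)
Lemma agency_shape_ratio_lt (R : realType) (f : R -> R) (x y : R) :
  agency_shape f -> 0 < x -> x < y -> y < 1 -> f y / y < f x / x.
Proof.
move=> hf x0 xy y1; have x1 := lt_trans xy y1; have y0 := lt_trans x0 xy.
have /andP[_ chord] := agency_shape_chord hf x0 xy y1.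
have tangent := @agency_shape_tangent _ f x hf ltac:(by rewrite x0).
rewrite ltr_pdivrMr// mulrAC ltr_pdivlMr//.
have : x * (f y - f x) < x * (derive1 f x * (y - x)) by rewrite ltr_pM2l.
have : x * derive1 f x * (y - x) <= f x * (y - x).
  by rewrite ler_pM2r ?subr_gt0.
nra.
Qed.

(** * Order statistics *)

(** In descending order, an item below [x] at index [k] confines the entries at or above [x] to the
    first [k] places; otherwise that item and its [k] predecessors are all at or above [x]. *)
Lemma nth_sort_ge_ltr (R : realType) (s : seq R) (k : nat) (x : R) :
  (k < size s)%N ->
  (nth 0 (sort >=%R s) k < x) = (count (>= x) s <= k)%N.
Proof.
move=> ks; rewrite -(count_sort >=%R); set t := sort _ s.
have kt : (k < size t)%N by rewrite size_sort.
have tS : sorted >=%R t by apply: sort_sorted => a b; exact: le_total.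
have tr : transitive (>=%R : rel R) by move=> a b c /= ba cb; exact: le_trans ba.
have mono i j : (i <= j)%N -> (j < size t)%N -> t`_j <= t`_i.
  move=> ij jt; apply: (sorted_leq_nth tr _ 0 tS) => //.
    by move=> a; exact: lexx.
  by rewrite inE (leq_ltn_trans ij).
have [lt_x|le_x] := ltP.
- rewrite -(cat_take_drop k t) count_cat.
  have /eqP -> : count (>= x) (drop k t) == 0%N.
    rewrite -leqn0 leqNgt -has_count; apply/hasPn => _ /(nthP 0)[i + <-].
    rewrite size_drop nth_drop -ltNge => idrop.
    apply: le_lt_trans lt_x; apply: mono; first exact: leq_addr.
    by rewrite -ltn_subRL.
  by rewrite addn0 (leq_trans (count_size _ _))// size_take_min geq_minl.
- apply/esym/negbTE; rewrite -ltnNge -(cat_take_drop k.+1 t) count_cat.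
  have -> : count (>= x) (take k.+1 t) = k.+1.
    rewrite -[RHS](@size_takel k.+1 _ t)//; apply/eqP; rewrite -all_count.
    apply/allP => _ /(nthP 0)[i + <-]; rewrite size_takel// => ik.
    by rewrite nth_take// (le_trans le_x)// mono.
  by rewrite leq_addr.
Qed.

(** * Poisson and uniform laws in closed form *)

Lemma poisson_prob_set1 (R : realType) (rate : R) (k n : nat) : 0 <= rate ->
  poisson_prob rate k [set n] = (expR (- rate) * (rate ^+ n / n`!%:R))%:E.
Proof.
rewrite /poisson_prob le_eqVlt => /predU1P[<-|rate0].
  (* At rate 0 the law is the Dirac mass at 0, which fits the formula because [0 ^+ 0 = 1]. *)
  rewrite ltxx oppr0 expR0 mul1r diracE expr0n.
  have -> : (0%N \in [set n]) = (n == 0%N).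
    by apply/idP/idP => [|/eqP ->]; rewrite inE// => ->.
  by case: n => [|n]; rewrite ?fact0 ?divr1 ?mul0r.
rewrite rate0 esum_set1 ?lee_fin ?poisson_pmf_ge0//.
by rewrite /poisson_pmf rate0 mulrC.
Qed.

Lemma uniform_prob_ge (R : realType) (a b x : R) (ab : a < b) :
  a <= x <= b -> uniform_prob ab `[x, +oo[ = ((b - x) / (b - a))%:E.
Proof.
move=> /andP[ax xb]; rewrite /uniform_prob integral_uniform_pdf.
have -> : `[x, +oo[ `&` `[a, b] = `[x, b]%classic.
  apply/seteqP; split=> y /=; rewrite !in_itv/= ?andbT.
    by move=> [-> /andP[]].
  by move=> /andP[xy yb]; rewrite xy (le_trans ax xy).
rewrite (eq_integral (cst (b - a)^-1%:E)) => [|y]; last first.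
  rewrite inE/= in_itv/= => /andP[xy yb].
  by rewrite /uniform_pdf (le_trans ax xy) yb.
rewrite integral_cst//= lebesgue_measure_itv/= lte_fin.
move: xb; rewrite le_eqVlt => /predU1P[->|xb].
  by rewrite ltxx subrr mul0r mule0.
by rewrite xb -EFinB -EFinM mulrC.
Qed.

(* The term of index [n] is the probability of [k] successes among a Poisson
   number [n] of trials; those of index below [k] vanish and the others form
   the exponential series at [mu * (1 - p)]. *)
Lemma poisson_binomial_series (R : realType) (mu p : R) (k : nat) :
  0 <= mu -> 0 <= p <= 1 ->
  (\sum_(n <oo) ((expR (- mu) * (mu ^+ n / n`!%:R))
     * (p ^+ k * (1 - p) ^+ (n - k) *+ 'C(n, k)))%:E)%E
  = (expR (- (mu * p)) * ((mu * p) ^+ k / k`!%:R))%:E.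
Proof.
move=> mu0 /andP[p0 p1]; have q0 : 0 <= 1 - p by rewrite subr_ge0.
pose a n := ((expR (- mu) * (mu ^+ n / n`!%:R))
  * (p ^+ k * (1 - p) ^+ (n - k) *+ 'C(n, k)))%:E.
rewrite -[LHS]/(\sum_(n <oo) a n)%E.
have a0 n : (0 <= a n)%E.
  by rewrite /a lee_fin !mulr_ge0 ?mulrn_wge0 ?mulr_ge0 ?exprn_ge0 ?expR_ge0
    ?invr_ge0.
rewrite (nneseries_split 0 k)//= add0n big_mkord big1 => [|i _]; last first.
  by rewrite /a bin_small ?ltn_ord// mulr0n mulr0.
rewrite add0e -nneseries_addn//.
set C := expR (- mu) * ((mu * p) ^+ k / k`!%:R).
have C0 : 0 <= C by rewrite !mulr_ge0 ?exprn_ge0 ?mulr_ge0 ?expR_ge0 ?invr_ge0.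
have aE j : a (j + k)%N = (C%:E * (exp_coeff (mu * (1 - p)) j)%:E)%E.
  rewrite /a /C /exp_coeff/= -EFinM addnK -[_ *+ 'C(_, _)]mulr_natr.
  congr _%:E; rewrite exprD !exprMn.
  have F n : n`!%:R != 0 :> R by rewrite pnatr_eq0 -lt0n fact_gt0.
  (* Writing [(j + k)!] as the binomial coefficient times [k! * j!] cancels that coefficient. *)
  have := bin_fact (leq_addl j k); rewrite addnK => /(congr1 (GRing.natmul (1 : R))).
  rewrite !natrM => <-.
  have B : ('C(j + k, k))%:R != 0 :> R.
    by rewrite pnatr_eq0 -lt0n bin_gt0 leq_addl.
  by field; rewrite !F B.
under eq_eseriesr do rewrite aE.
rewrite nneseriesZl; last first.
  by move=> j _; rewrite lee_fin exp_coeff_ge0 ?mulr_ge0.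
have -> : (\sum_(j <oo) (exp_coeff (mu * (1 - p)) j)%:E)%E
    = (expR (mu * (1 - p)))%:E.
  rewrite /expR -EFin_lim; last exact: is_cvg_series_exp_coeff.
  by apply/congr_lim/funext => n/=; rewrite -sumEFin.
rewrite -EFinM /C mulrAC -expRD; congr (expR _ * _)%:E; ring.
Qed.

(** * Independence and decomposition of events *)

Lemma measurable_noise_count (R : realType) (X : noise_model R) (n : nat) :
  measurable [set w | noise_count X w = n].
Proof. exact: (measurable_funPTI (noise_count X) (Y := [set n])). Qed.

Lemma measurable_noise_estimate (R : realType) (X : noise_model R) (i : nat)
    (B : set R) :
  measurable B -> measurable [set w | B (noise_estimate X i w)].
Proof. exact: (measurable_funPTI (noise_estimate X i) (Y := B)). Qed.

Lemma noise_count_estimates_independent (R : realType) (X : noise_model R)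
    (n : nat) (B : 'I_n -> set R) :
  mutually_independent (nm_prob X) (@noise_sigma R X) ->
  (forall i, measurable (B i)) ->
  nm_prob X [set w | noise_count X w = n
                     /\ forall i, B i (noise_estimate X i w)]
  = (nm_prob X [set w | noise_count X w = n]
     * \prod_(i < n) nm_prob X [set w | B i (noise_estimate X i w)])%E.
Proof.
move=> indep mB.
(* Padding with the full line beyond [n] extends the family to all indices, as the definition of
   independence requires; the finite index set [s] then selects the count and the first [n]
   estimates. *)
pose B' k : set R := if insub k is Some i then B i else setT.
have B'E (i : 'I_n) : B' i = B i by rewrite /B' valK.
have mB' k : measurable (B' k) by rewrite /B'; case: insub.
pose A j : set (nm_space X) :=
  if j is Some k then [set w | B' k (noise_estimate X k w)]
  else [set w | noise_count X w = n].
pose s := None :: [seq Some (val i) | i <- enum 'I_n].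
have us : uniq s.
  rewrite /= map_inj_uniq ?enum_uniq => [|i j [/val_inj]//].
  by rewrite andbT; apply/mapP => -[].
have := indep [fset j in s]%fset A.
have -> : \bigcap_(j in [set` [fset j in s]%fset]) A j
    = [set w | noise_count X w = n /\ forall i, B i (noise_estimate X i w)].
  apply/seteqP; split => [w Aw | w [Nw Bw] j /=].
    split; first by apply: (Aw None); rewrite /= !inE.
    move=> i; have := Aw (Some (val i)); rewrite /A /= B'E; apply.
    by rewrite !inE map_f ?mem_enum.
  rewrite !inE => /orP[/eqP->//|/mapP[i _ ->]].
  by rewrite /A /= B'E.
rewrite (perm_big s)/=; last first.
  apply: uniq_perm => //; first exact: fset_uniq.
  by move=> j; rewrite in_fset.
rewrite big_cons big_map big_enum /= => -> //.
  by congr (_ * _)%E; apply: eq_bigr => i _; rewrite B'E.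
move=> [k|] _; rewrite /noise_sigma /A.
  by exists (B' k).
by exists [set n].
Qed.

(** Only the slices are assumed measurable, so [Z] may take values in a type without a
    sigma-algebra, such as sets of indices. *)
Lemma measure_preimage_seq d (T : measurableType d) (R : realType)
    (mu : {measure set T -> \bar R}) (I : choiceType) (E : set T) (Z : T -> I)
    (r : seq I) :
  uniq r -> (forall i, measurable (E `&` [set w | Z w = i])) ->
  mu (E `&` [set w | Z w \in r])
  = (\sum_(i <- r) mu (E `&` [set w | Z w = i]))%E.
Proof.
move=> ur mE; have -> : E `&` [set w | Z w \in r]
    = \bigcup_(i in [set` r]) (E `&` [set w | Z w = i]).
  apply/seteqP; split => [w [Ew Zw]|w [i ri [Ew /= Zw]]].
    by exists (Z w).
  by split => //=; rewrite Zw.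
rewrite measure_fin_bigcup//; first by rewrite -fsbig_seq.
by move=> i j _ _ [w [[_ <-] [_ <-]]].
Qed.

Lemma measure_preimage_nat d (T : measurableType d) (R : realType)
    (mu : {measure set T -> \bar R}) (E : set T) (Z : T -> nat) :
  (forall n, measurable (E `&` [set w | Z w = n])) ->
  mu E = (\sum_(n <oo) mu (E `&` [set w | Z w = n]))%E.
Proof.
move=> mE; have UE : \bigcup_n (E `&` [set w | Z w = n]) = E.
  apply/seteqP; split => [w [n _ []]//|w Ew].
  by exists (Z w).
rewrite -measure_semi_bigcup ?UE//.
- by move=> i j _ _ [w [[_ <-] [_ <-]]].
- by rewrite -UE; exact: bigcup_measurable.
Qed.

(** * Poisson thinning of the noise traders *)

(** Recording which estimates reach [x], and not only how many, makes each event an intersection of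
    conditions on single estimates, to which independence applies. *)
Definition estimates_above (R : realType) (X : noise_model R) (x : R) (n : nat)
    (w : nm_space X) : {set 'I_n} := [set i : 'I_n | x <= noise_estimate X i w].

Definition above_count (R : realType) (X : noise_model R) (x : R)
    (w : nm_space X) : nat :=
  count (fun i => x <= noise_estimate X i w) (iota 0 (noise_count X w)).

Lemma card_estimates_above (R : realType) (X : noise_model R) (x : R)
    (w : nm_space X) :
  #|estimates_above x (noise_count X w) w| = above_count x w.
Proof.
rewrite /above_count -sum1_count -sum1_card.
rewrite -[X in iota 0 X]subn0 -/(index_iota 0 _) big_mkord.
by apply: eq_bigl => i; rewrite inE.
Qed.

Lemma estimates_above_setE (R : realType) (X : noise_model R) (x : R) (n : nat)
    (A : {set 'I_n}) :
  [set w : nm_space X | estimates_above x n w = A]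
  = [set w | forall i : 'I_n,
      [set y | (x <= y) = (i \in A)] (noise_estimate X i w)].
Proof.
apply/seteqP; split => [w <- i /=|w wA]; first by rewrite inE.
by apply/setP => i; rewrite inE; exact: wA.
Qed.

Lemma measurable_ge_eq (R : realType) (x : R) (b : bool) :
  measurable [set y : R | (x <= y) = b].
Proof.
have -> : [set y : R | (x <= y) = b]
    = if b then `[x, +oo[%classic else ~` `[x, +oo[%classic.
  apply/seteqP; split=> y; case: b; rewrite /= ?in_itv/= ?andbT//.
    by move=> ->.
  by move/negP/negbTE.
by case: b; [|apply: measurableC].
Qed.

Section thinning.
Context (R : realType) (X : noise_model R) (x p : R).
Hypothesis indep : mutually_independent (nm_prob X) (@noise_sigma R X).
Hypothesis p_ge : forall i, nm_prob X [set w | x <= noise_estimate X i w] = p%:E.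

Let P := nm_prob X.

Lemma prob_estimate_ge_eq (i : nat) (b : bool) :
  P [set w | (x <= noise_estimate X i w) = b] = (if b then p else 1 - p)%:E.
Proof.
case: b; first exact: p_ge.
rewrite EFinB -(p_ge i) -probability_setC; last first.
  exact: measurable_noise_estimate (measurable_ge_eq x true).
congr (P _); apply/seteqP; split => w /=; last by move/negP/negbTE.
by move=> ->.
Qed.

(** By independence each index in [A] contributes a factor [p] and each other index a factor
    [1 - p]. *)
Lemma prob_count_estimates_above (n : nat) (A : {set 'I_n}) :
  P ([set w | noise_count X w = n] `&` [set w | estimates_above x n w = A])
  = (P [set w | noise_count X w = n]
     * (p ^+ #|A| * (1 - p) ^+ (n - #|A|))%:E)%E.
Proof.
have := noise_count_estimates_independent indep
  (fun i : 'I_n => measurable_ge_eq x (i \in A)).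
rewrite estimates_above_setE => ->; congr (_ * _)%E.
under eq_bigr do rewrite prob_estimate_ge_eq.
rewrite prodEFin; congr _%:E.
rewrite (bigID (mem A))/= (eq_bigr (fun=> p)) => [|i -> //].
rewrite [X in _ * X](eq_bigr (fun=> 1 - p)) => [|i /negbTE -> //].
rewrite !prodr_const; congr (_ * _ ^+ _).
by rewrite -[X in (X - _)%N]card_ord -(cardC (mem A)) addKn.
Qed.

Lemma measurable_count_estimates_above (n : nat) (A : {set 'I_n}) :
  measurable ([set w | noise_count X w = n]
              `&` [set w | estimates_above x n w = A]).
Proof.
apply: measurableI; first exact: measurable_noise_count.
rewrite estimates_above_setE.
have -> : [set w | forall i : 'I_n,
      [set y | (x <= y) = (i \in A)] (noise_estimate X i w)]
    = \bigcap_(i in [set: 'I_n])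
        [set w | [set y | (x <= y) = (i \in A)] (noise_estimate X i w)].
  by apply/seteqP; split => w wA i; [move=> _; exact: wA|exact: (wA i)].
apply: fin_bigcap_measurable => // i _.
exact: measurable_noise_estimate (measurable_ge_eq _ _).
Qed.

Lemma count_above_countE (n k : nat) :
  [set w | above_count x w = k] `&` [set w | noise_count X w = n]
  = [set w | noise_count X w = n] `&`
    [set w | estimates_above x n w \in enum [pred A : {set 'I_n} | #|A| == k]].
Proof.
apply/seteqP; split => w [/= w1 w2]; split => //=; subst.
  by rewrite mem_enum inE /= card_estimates_above.
by move: w2; rewrite mem_enum inE /= card_estimates_above => /eqP.
Qed.

Lemma measurable_count_above_count (n k : nat) :
  measurable ([set w | above_count x w = k]
              `&` [set w | noise_count X w = n]).
Proof.
rewrite count_above_countE.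
set s := enum _; have -> : [set w | noise_count X w = n] `&`
    [set w | estimates_above x n w \in s] = \bigcup_(A in [set` s])
    ([set w | noise_count X w = n] `&` [set w | estimates_above x n w = A]).
  apply/seteqP; split => [w [Ew Zw]|w [i ri [Ew /= Zw]]].
    by exists (estimates_above x n w).
  by split => //=; rewrite Zw.
apply: fin_bigcup_measurable => // A _.
exact: measurable_count_estimates_above.
Qed.

(** The event splits over the ['C(n, k)] index sets of size [k], which all have the same
    probability. *)
Lemma prob_count_above_count (n k : nat) :
  P ([set w | above_count x w = k] `&` [set w | noise_count X w = n])
  = (P [set w | noise_count X w = n]
     * (p ^+ k * (1 - p) ^+ (n - k) *+ 'C(n, k))%:E)%E.
Proof.
rewrite count_above_countE measure_preimage_seq ?enum_uniq//; last first.
  exact: measurable_count_estimates_above.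
rewrite big_enum/= (eq_bigr (fun=> (P [set w | noise_count X w = n]
    * (p ^+ k * (1 - p) ^+ (n - k))%:E)%E)) => [|A]; last first.
  by rewrite inE => /eqP <-; rewrite prob_count_estimates_above.
have -> : P [set w | noise_count X w = n]
    = (fine (P [set w | noise_count X w = n]))%:E.
  by rewrite fineK// fin_num_measure//; exact: measurable_noise_count.
rewrite -!EFinM sumEFin sumr_const mulrnAr; congr (_ *+ _)%:E.
by rewrite -[in RHS](card_ord n) -card_draws cardsE.
Qed.

Lemma measurable_above_count (k : nat) :
  measurable [set w : nm_space X | above_count x w = k].
Proof.
have <- : \bigcup_n ([set w | above_count x w = k]
                     `&` [set w | noise_count X w = n])
    = [set w | above_count x w = k].
  apply/seteqP; split => [w [n _ []]//|w wk].
  by exists (noise_count X w).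
by apply: bigcup_measurable => n _; exact: measurable_count_above_count.
Qed.

Hypothesis p01 : 0 <= p <= 1.
Variable mu : R.
Hypothesis mu_ge0 : 0 <= mu.
Hypothesis noise_poisson : forall n,
  P [set w | noise_count X w = n] = (expR (- mu) * (mu ^+ n / n`!%:R))%:E.

(** Total probability over the number of noise traders yields the series of
    [poisson_binomial_series]. *)
Lemma prob_above_count (k : nat) :
  P [set w | above_count x w = k]
  = (expR (- (mu * p)) * ((mu * p) ^+ k / k`!%:R))%:E.
Proof.
rewrite (@measure_preimage_nat _ _ _ _ _ (noise_count X)); last first.
  by move=> n; exact: measurable_count_above_count.
rewrite -poisson_binomial_series//; apply: eq_eseriesr => n _.
by rewrite [LHS](prob_count_above_count n k) noise_poisson EFinM.
Qed.

Lemma prob_above_count_le (m : nat) :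
  P [set w | (above_count x w <= m)%N] = (poisson_cdf m (mu * p))%:E.
Proof.
have -> : [set w : nm_space X | (above_count x w <= m)%N]
    = setT `&` [set w | above_count x w \in index_iota 0 m.+1].
  by apply/seteqP; split => w /=; rewrite mem_index_iota ltnS// => -[].
rewrite measure_preimage_seq ?iota_uniq//; last first.
  by move=> k; rewrite setTI; exact: measurable_above_count.
under eq_bigr => k _ do rewrite setTI [_ [set _ | _]](prob_above_count k).
by rewrite sumEFin /poisson_cdf /exp_sum mulr_sumr.
Qed.

End thinning.

(** * Price drops and the closed form of the liquidity index *)

(** All [NI] informed estimates reach [x], so the price is below [x] exactly when
    [NI + above_count x w <= M]. With at most [M] traders both sides hold, the price being the low
    value. *)
Lemma market_price_lt (R : realType) (Vbar c rho x : R) (NI M : nat)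
    (X : noise_model R) (w : nm_space X) :
  (NI <= M)%N -> low_value Vbar c < x -> x <= fair_value Vbar rho ->
  (market_price Vbar NI M c rho w < x) = (above_count x w <= M - NI)%N.
Proof.
move=> NIM low_x x_fair.
have countE : count (>= x) (estimates Vbar NI rho w)
    = (NI + above_count x w)%N.
  rewrite /estimates count_cat count_nseq /= x_fair mul1n count_map.
  by congr (_ + _)%N; apply: eq_count.
rewrite leq_subRL// -countE /market_price size_sort.
case: ltnP => [lt_M|le_M]; first exact: nth_sort_ge_ltr.
by rewrite low_x (leq_trans (count_size _ _)).
Qed.

(* The probability that a noise trader's estimate is at least
   [(1 - s0) * fair_value Vbar rho]. *)
Definition above_prob (R : realType) (s0 c rho : R) : R :=
  (s0 + (1 - s0) * rho) / c.

Section liquidity_index.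
Context (R : realType) (c rho s0 : R).
Hypotheses (c0 : 0 < c) (c1 : c < 1) (rho0 : 0 <= rho) (rhoc : rho <= c).
Hypotheses (s00 : 0 <= s0) (s0_lt : s0 < liquidity_threshold c rho).

Let rho1 : 0 < 1 - rho.
Proof. by rewrite subr_gt0 (le_lt_trans rhoc). Qed.

(** Rearranged, this says both [1 - c < (1 - s0) * (1 - rho)], so the price level exceeds the low
    value, and [s0 + (1 - s0) * rho < c], so [above_prob] is below 1. *)
Let s0_rho : s0 * (1 - rho) < c - rho.
Proof. by rewrite -ltr_pdivlMr. Qed.

Lemma liquidity_threshold_lt1 : s0 < 1.
Proof.
by rewrite (lt_trans s0_lt)// ltr_pdivrMr// mul1r ltrD2r.
Qed.

Lemma above_prob_itv : 0 <= above_prob s0 c rho <= 1.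
Proof.
have s01 := liquidity_threshold_lt1.
rewrite divr_ge0 ?(ltW c0) ?addr_ge0 ?mulr_ge0 ?subr_ge0 ?(ltW s01)//=.
rewrite ler_pdivrMr// mul1r; move: s0_rho; nra.
Qed.

Lemma ILL_noise_law (Vbar dT lambda : R) (NI M : nat) (X : noise_model R) :
  0 < Vbar -> 0 < dT -> 0 <= lambda -> (NI <= M)%N ->
  noise_law Vbar dT c lambda X ->
  ILL Vbar NI M c rho X s0
  = (- ln (poisson_cdf (M - NI) (lambda * dT * above_prob s0 c rho)))%:E.
Proof.
move=> V0 dT0 lam0 NIM [lawN [ab lawY] indep].
have mu0 : 0 <= lambda * dT by rewrite mulr_ge0// ltW.
pose x := (1 - s0) * fair_value Vbar rho.
have low_x : low_value Vbar c < x.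
  rewrite /low_value /x /fair_value mulrA ltr_pM2r//.
  by move: s0_rho; nra.
have s01 := liquidity_threshold_lt1.
have fair0 : 0 < fair_value Vbar rho by rewrite mulr_gt0.
have x_fair : x <= fair_value Vbar rho by rewrite ger_pMl// gerBl.
have fair_V : fair_value Vbar rho <= Vbar by rewrite ger_pMl// gerBl.
have p_ge i : nm_prob X [set w | x <= noise_estimate X i w]
    = (above_prob s0 c rho)%:E.
  have -> : [set w | x <= noise_estimate X i w]
      = noise_estimate X i @^-1` `[x, +oo[.
    by apply/seteqP; split => w /=; rewrite in_itv/= andbT.
  rewrite -[LHS]/(distribution (nm_prob X) (noise_estimate X i) `[x, +oo[).
  rewrite lawY// uniform_prob_ge; last by rewrite (ltW low_x) (le_trans x_fair).
  congr _%:E; rewrite /above_prob /x /low_value /fair_value.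
  by field; rewrite !gt_eqF// subr_gt0.
have p_count n : nm_prob X [set w | noise_count X w = n]
    = (expR (- (lambda * dT)) * ((lambda * dT) ^+ n / n`!%:R))%:E.
  by rewrite -(poisson_prob_set1 0)// -lawN.
have F : price_drop_prob Vbar NI M c rho X s0
    = poisson_cdf (M - NI) (lambda * dT * above_prob s0 c rho).
  rewrite /price_drop_prob -/x.
  have -> : [set w : nm_space X | market_price Vbar NI M c rho w < x]
      = [set w | (above_count x w <= M - NI)%N].
    by apply/seteqP; split => w /=; rewrite market_price_lt.
  by rewrite (prob_above_count_le indep p_ge above_prob_itv mu0 p_count).
have /andP[p0 _] := above_prob_itv.
(* Positivity of the distribution function selects the finite branch of [ILL]. *)
by rewrite /ILL F poisson_cdf_gt0// mulr_ge0.
Qed.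

End liquidity_index.

(** * Effect of governance, and the comparison of the two participation levels *)

(** The probability is [s0 / c] plus a positive multiple of [f c / c]. The first term is only weakly
    decreasing in [c], being zero at [s0 = 0]; strictness comes from the second. *)
Lemma above_prob_agency_lt (R : realType) (theta s0 : R) (f : R -> R)
    (c1 c2 : R) :
  agency_shape f -> theta < 1 -> 0 <= s0 < 1 -> 0 < c2 -> c2 < c1 -> c1 < 1 ->
  0 < above_prob s0 c1 (agency_cost theta f c1)
    < above_prob s0 c2 (agency_cost theta f c2).
Proof.
move=> hf theta1 /andP[s00 s01] c20 c21 c11; have c10 := lt_trans c20 c21.
have [f1 _ _ _] : _ := hf c1 ltac:(by rewrite c10).
have k0 : 0 < (1 - s0) * ((1 - theta) / 2).
  by rewrite mulr_gt0 ?divr_gt0 ?subr_gt0.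
have apE c : above_prob s0 c (agency_cost theta f c)
    = s0 / c + (1 - s0) * ((1 - theta) / 2) * (f c / c).
  by rewrite /above_prob /agency_cost mulrDl !mulrA.
rewrite !apE; apply/andP; split.
  by rewrite ltr_wpDl ?divr_ge0 ?(ltW c10)// mulr_gt0 ?divr_gt0.
rewrite ler_ltD//; first by rewrite ler_wpM2l// lef_pV2 ?posrE// ltW.
by rewrite ltr_pM2l// agency_shape_ratio_lt.
Qed.

Theorem proposition5 (R : realType) (Vbar dT theta : R) (NI M : nat)
    (f : R -> R) (X : R -> R -> noise_model R)
    (hVbar : 0 < Vbar) (hM : (1 <= M)%N) (hNI : (NI <= M)%N) (hdT : 0 < dT)
    (htheta : 0 < theta < 1) (hf : agency_shape f)
    (hrho : forall c : R, 0 < c < 1 -> 0 <= agency_cost theta f c <= c)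
    (hX : forall c lambda : R, 0 < c < 1 -> 0 <= lambda ->
       noise_law Vbar dT c lambda (X c lambda))
    (c1 c2 : R) (hc2 : 0 < c2) (hc21 : c2 < c1) (hc1 : c1 < 1)
    (laml lamh : R) (hlaml : 0 <= laml) (hlam : laml < lamh)
    (s0 : R) (hs0 : 0 <= s0)
    (hs1 : s0 < liquidity_threshold c1 (agency_cost theta f c1))
    (hs2 : s0 < liquidity_threshold c2 (agency_cost theta f c2)) :
  (delta_ILL Vbar NI M (agency_cost theta f) X c1 c2 s0 lamh
   > delta_ILL Vbar NI M (agency_cost theta f) X c1 c2 s0 laml)%E.
Proof.
have [_ theta1] := andP htheta.
have h1 : 0 < c1 < 1 by rewrite (lt_trans hc2).
have h2 : 0 < c2 < 1 by rewrite hc2 (lt_trans hc21).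
have [c10 _] := andP h1; have [_ c21] := andP h2.
have [r10 r1c] := andP (hrho c1 h1); have [r20 r2c] := andP (hrho c2 h2).
have lamh0 : 0 <= lamh by rewrite (le_trans hlaml)// ltW.
have s01 := liquidity_threshold_lt1 hc1 r1c hs1.
have /andP[p10 p12] := above_prob_agency_lt hf theta1
  (introT andP (conj hs0 s01)) hc2 hc21 hc1.
have dE lambda (lam0 : 0 <= lambda) :=
  (ILL_noise_law c10 hc1 r10 r1c hs0 hs1 hVbar hdT lam0 hNI (hX c1 _ h1 lam0),
   ILL_noise_law hc2 c21 r20 r2c hs0 hs2 hVbar hdT lam0 hNI (hX c2 _ h2 lam0)).
rewrite /delta_ILL !dE// -!EFinB lte_fin !opprK ![- _ + _]addrC.
(* Here [p1], [p2] are the probabilities for [c1], [c2], and [a], [b] are [laml * dT],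
   [lamh * dT]. *)
apply: poisson_cdf_log_supermodular => //.
- by rewrite mulr_ge0// ltW.
- by rewrite ltr_pM2r.
Qed.
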